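(* Let $d,k\ge 1$ be integers. Every tensor in $(\mathbb{C}^{d+1})^{\otimes k}$ has a Vandermonde decomposition.
   Context: A (not necessarily symmetric) tensor $\mathcal{A}\in(\mathbb{C}^{d+1})^{\otimes k}$ is said to admit a Vandermonde decomposition if there exist an integer $r$ and complex numbers $a_{sj},b_{sj}$ ($s=1,\dots,k$, $j=1,\dots,r$) such that, with $$v_s^{(j)}:=\big((a_{sj})^d,(a_{sj})^{d-1}b_{sj},\dots,a_{sj}(b_{sj})^{d-1},(b_{sj})^d\big)\in\mathbb{C}^{d+1},$$ one has $\mathcal{A}=\sum_{j=1}^r v_1^{(j)}\otimes\cdots\otimes v_k^{(j)}$. *)

(* Defs.v *)
From HB Require Import structures.
From mathcomp Require Import all_boot all_order all_algebra.
From mathcomp Require Import reals complex.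

Set Implicit Arguments.
Unset Strict Implicit.
Unset Printing Implicit Defensive.

Import GRing.Theory.
Local Open Scope ring_scope.

(* A tensor in (K^n)^{\otimes k} is its array of coordinates in the basis
   e_{i_1} \otimes ... \otimes e_{i_k}, indexed by i : 'I_k -> 'I_n; addition is
   pointwise. *)
Notation tensor K k n := {ffun {ffun 'I_k -> 'I_n} -> K}.

Section Tensors.
Variable K : comNzRingType.

Definition pure_tensor (k n : nat) (v : 'I_k -> 'rV[K]_n) : tensor K k n :=
  [ffun i : {ffun 'I_k -> 'I_n} => \prod_(s < k) v s 0 (i s)].

(* x ^+ 0 = 1 even for x = 0, so a = 0 gives (0, ..., 0, b ^+ d). *)
Definition vandermonde_vector (d : nat) (a b : K) : 'rV[K]_d.+1 :=
  \row_(i < d.+1) (a ^+ (d - i) * b ^+ i).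

Definition has_vandermonde_decomposition (d k : nat) (A : tensor K k d.+1) :
    Prop :=
  exists (r : nat) (a b : 'I_k -> 'I_r -> K),
    A = \sum_(j < r)
          pure_tensor (fun s => vandermonde_vector d (a s j) (b s j)).

End Tensors.

(* Main.v *)
(** Rescaling the defining pair by [g] multiplies a Vandermonde vector by
    [g ^+ d], so over an algebraically closed field every scalar multiple of a
    pure tensor of Vandermonde vectors is again one (this uses [1 <= d] and
    [1 <= k]).  It thus suffices that such pure tensors span; this holds since
    the vectors attached to the pairs [(1, 0), ..., (1, d)] form a basis, by
    the Vandermonde determinant. *)

Require Import Defs.
From mathcomp Require Import all_boot all_order all_algebra.
From mathcomp Require Import reals complex.

Import GRing.Theory Num.Theory.
Local Open Scope ring_scope.

Lemma Vandermonde_unitmx (F : fieldType) (n : nat) (t : 'rV[F]_n) :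
  injective (t 0) -> Vandermonde n t \in unitmx.
Proof.
move=> t_inj; rewrite unitmxE det_Vandermonde unitfE.
apply/prodf_neq0 => i _; apply/prodf_neq0 => j lt_ij.
by rewrite subr_eq0 (inj_eq t_inj) -val_eqE gtn_eqF.
Qed.

(** Insert [V *m W = 1%:M] in every slot, distribute the product of sums over all [f], and exchange
    sums: the inner sums are the coordinates of [A] in the basis of tensor products of columns of
    [V]. *)
Lemma tensor_expand (K : comNzRingType) (k n : nat) (V W : 'M[K]_n)
    (A : tensor K k n) (i : {ffun 'I_k -> 'I_n}) :
  V *m W = 1%:M ->
  A i = \sum_(f : {ffun 'I_k -> 'I_n})
          (\sum_(l : {ffun 'I_k -> 'I_n}) A l * \prod_(s < k) W (f s) (l s))
          * \prod_(s < k) V (i s) (f s).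
Proof.
move=> VW1.
have delta (l : {ffun 'I_k -> 'I_n}) :
    \prod_(s < k) (V *m W) (i s) (l s) = (i == l)%:R.
  rewrite VW1; have [<-|neq_il] := eqVneq i l.
    by rewrite big1 // => s _; rewrite mxE eqxx.
  have /existsP[s neq_s] : [exists s, i s != l s].
    rewrite -negb_forall; apply: contra neq_il => /forallP eq_il.
    by apply/eqP/ffunP => s; apply/eqP.
  by rewrite (bigD1 s) //= mxE (negPf neq_s) mul0r.
transitivity (\sum_l A l * \prod_(s < k) (V *m W) (i s) (l s)).
  rewrite (bigD1 i) //= delta eqxx mulr1 big1 ?addr0 // => l neq_li.
  by rewrite delta eq_sym (negPf neq_li) mulr0.
under eq_bigr => l _.
  under eq_bigr => s _ do rewrite mxE.
  rewrite bigA_distr_bigA mulr_sumr /=.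
  over.
rewrite exchange_big; apply: eq_bigr => f _.
rewrite mulr_suml; apply: eq_bigr => l _.
by rewrite big_split /= mulrA mulrAC.
Qed.

Lemma has_vandermonde_decomposition_closed (C : numClosedFieldType) (d k : nat)
    (A : tensor C k d.+1) :
  (0 < d)%N -> (0 < k)%N -> has_vandermonde_decomposition A.
Proof.
move=> d_gt0 k_gt0; pose s0 := Ordinal k_gt0.
pose t : 'rV[C]_d.+1 := \row_(j < d.+1) j%:R.
pose V := Vandermonde d.+1 t; pose W := invmx V.
have VW1 : V *m W = 1%:M.
  (* The nodes [0, ..., d] are distinct in [C] by characteristic zero. *)
  apply/mulmxV/Vandermonde_unitmx => i j.
  by rewrite !mxE => /eqP; rewrite eqr_nat => /eqP/val_inj.
pose c (f : {ffun 'I_k -> 'I_d.+1}) :=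
  \sum_(l : {ffun 'I_k -> 'I_d.+1}) A l * \prod_(s < k) W (f s) (l s).
(* The whole coefficient [c f] is absorbed in slot [s0]. *)
pose g f s := if s == s0 then d.-root (c f) else 1.
have prod_g f : \prod_(s < k) g f s ^+ d = c f.
  rewrite (bigD1 s0) //= {1}/g eqxx rootCK // big1 ?mulr1 // => s neq_s.
  by rewrite /g (negPf neq_s) expr1n.
(* One term per multi-index [f]: slot [s] carries the pair [(1, t 0 (f s))] rescaled by [g f s]. *)
exists #|{ffun 'I_k -> 'I_d.+1}|.
exists (fun s j => g (enum_val j) s).
exists (fun s j => g (enum_val j) s * t 0 (enum_val j s)).
apply/ffunP => i; rewrite sum_ffunE (tensor_expand _ _ _ V W) //.
rewrite (reindex (@enum_val _ predT)); last exact: onW_bij (@enum_val_bij _).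
apply: eq_bigr => j _; rewrite -/(c _) -prod_g -big_split ffunE.
(* The powers of [g] combine to exponent [d - i s + i s], which is [d] because [i s <= d]. *)
apply: eq_bigr => s _; rewrite !mxE exprMn mulrA -exprD subnK //.
by rewrite -ltnS.
Qed.

Theorem theorem3p6 (R : realType) (d k : nat) (hd : (1 <= d)%N) (hk : (1 <= k)%N)
    (A : tensor R[i] k d.+1) :
  has_vandermonde_decomposition A.
Proof. exact: has_vandermonde_decomposition_closed. Qed.
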